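(* Assume that there exists a construction scheme (of some type $(m_k,n_k,r_k)_{k<\omega}$) that is $3$-capturing. Then there is an $(\omega_1,\omega_1)$-gap $(a_\alpha,b_\alpha)_{\alpha<\omega_1}$ that is a T-gap; and so, in particular, there is an $(\omega_1,\omega_1)$-gap that can be filled in a forcing extension over a partially ordered set satisfying the countable chain condition.
   Context: Gaps. For infinite $a,a'\subset\omega$ write $a\subseteq^* a'$ if $a\setminus a'$ is finite. A sequence $(a_\alpha,b_\alpha)_{\alpha<\omega_1}$ of pairs of infinite subsets of $\omega$ is a pre-gap if $a_\alpha\cap b_\alpha=\emptyset$ for all $\alpha$; $a_\alpha\subseteq^* a_\beta$ and $b_\alpha\subseteq^* b_\beta$ for all $\alpha<\beta<\omega_1$; and $a_\delta\cap b_\gamma$ is finite for all $\delta,\gamma<\omega_1$. It is a gap (an $(\omega_1,\omega_1)$-gap) if it is a pre-gap and there is no infinite $c\subset\omega$ such that $a_\alpha\subseteq^* c$ and $b_\alpha\cap c$ is finite for every $\alpha<\omega_1$. A gap is filled (split) in a forcing extension if such a $c$ exists in that extension. A gap $(a_\alpha,b_\alpha)_{\alpha<\omega_1}$ is a T-gap if for every uncountable $\Gamma\subset\omega_1$ there are $\alpha<\beta$ in $\Gamma$ such that $a_\alpha\subseteq a_\beta$ and $b_\alpha\subseteq b_\beta$. For bounded subsets $A,B\subset\omega_1$, write $A<B$ if $a<b$ for all $a\in A$, $b\in B$. A $\Delta$-system with root $s$ is a sequence $(s_\xi)_{\xi<\gamma}$ of finite subsets of $\omega_1$ ($\gamma\le\omega_1$)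 with $s_\xi\cap s_\eta=s$ for all $\xi<\eta<\gamma$. It is increasing if moreover $s<(s_\xi\setminus s)<(s_\eta\setminus s)$ for all $\xi<\eta<\gamma$. Type. Let $(m_k)_{k<\omega}$, $(n_k)_{1\le k<\omega}$, $(r_k)_{1\le k<\omega}$ be sequences of natural numbers such that $m_0=1$, $m_{k-1}>r_k$ for all $k>0$, $n_k>k$ for all $k>0$, and for every $r<\omega$ there are infinitely many $k$ with $r_k=r$. If $m_k=n_k(m_{k-1}-r_k)+r_k$ for every $k>0$, then $(m_k,n_k,r_k)_{k<\omega}$ is called a type. Construction scheme. A family $\mathcal F$ of finite subsets of $\omega_1$ such that for every finite $A\subset\omega_1$ there is $F\in\mathcal F$ with $A\subset F$ is a construction scheme of type $(m_k,n_k,r_k)_{k<\omega}$ if there are two mappings $\rho:\mathcal F\to\omega$ (the rank; write $\rho^F=\rho(F)$) and $R:\mathcal F\to[\omega_1]^{<\omega}$ such that members of rank $0$ are singletons and, for every $F\in\mathcal F$ with $\rho^F=k>0$: (i) $|F|=m_k$ and $|R(F)|=r_k$; (ii) there are unique $F_i\in\mathcal F$ ($i<n_k$) such that $\rho^{F_i}=k-1$ and $F=\bigcup_{i<n_k}F_i$; furthermore $(F_i)_{i<n_k}$ forms an increasing $\Delta$-system with root $R(F)$, i.e. $F_i\cap F_j=R(F)$ for $i\neq j$ and $R(F)<F_0\setminus R(F)<\dots<F_{n_k-1}\setminus R(F)$. The sequence $(F_i)_{i<n_k}$ is the canonical decomposition of $F$. Let $\varphi_i:F_0\to F_i$ denote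 the unique order-preserving bijection. Capturing. A construction scheme $\mathcal F$ is $n$-capturing if for every uncountable $\Delta$-system $(s_\xi)_{\xi<\omega_1}$ of finite subsets of $\omega_1$ with root $s$ there are a sub-$\Delta$-system $(s_{\xi_i})_{i<n}$ (with $\xi_0<\dots<\xi_{n-1}$) and $F\in\mathcal F$ with $k=\rho^F>0$ and canonical decomposition $F=\bigcup_{i<n_k}F_i$, such that $s\subset R(F)$, $s_{\xi_0}\setminus s\subset F_0\setminus R(F)$, and $\varphi_i(s_{\xi_0}\setminus s)=s_{\xi_i}\setminus s\subset F_i\setminus R(F)$ for all $i<n$ (where $\varphi_i$ of a set denotes its image).
   Formalization: The definition of construction scheme is completed by the clause that any two members of the same rank intersect in an initial segment of both; without it, capturing schemes exist in ZFC and the claim fails under Martin's axiom. *)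

(* Defs.v *)
From HB Require Import structures.
From mathcomp Require Import all_boot all_order.
From mathcomp Require Import finmap.
From mathcomp Require Import boolp classical_sets functions cardinality.

Set Implicit Arguments.
Unset Strict Implicit.
Unset Printing Implicit Defensive.

Import Order.TTheory.

Local Open Scope classical_set_scope.
Local Open Scope order_scope.

(** * The ordinal omega_1

   omega_1 is presented as an arbitrary well-order of that type (any two are
   isomorphic): uncountable, with all proper initial segments countable. *)

Definition is_omega1 (d : Order.disp_t) (W : orderType d) : Prop :=
  [/\ well_founded (fun x y : W => x < y),
      forall x : W, countable [set y : W | y < x]
    & ~ countable [set: W]].

(** * Gaps *)

Definition almost_subset (x y : set nat) : Prop := finite_set (x `\` y).

Definition pregap (d : Order.disp_t) (W : orderType d) (a b : W -> set nat) : Prop :=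
  [/\ forall alpha, infinite_set (a alpha) /\ infinite_set (b alpha),
      forall alpha, a alpha `&` b alpha = set0,
      forall alpha beta, alpha < beta ->
        almost_subset (a alpha) (a beta) /\ almost_subset (b alpha) (b beta)
    & forall delta gamma, finite_set (a delta `&` b gamma)].

Definition fills (d : Order.disp_t) (W : orderType d) (a b : W -> set nat)
    (c : set nat) : Prop :=
  infinite_set c /\
  forall alpha, almost_subset (a alpha) c /\ finite_set (b alpha `&` c).

Definition gap (d : Order.disp_t) (W : orderType d) (a b : W -> set nat) : Prop :=
  pregap a b /\ ~ exists c : set nat, fills a b c.

Definition T_gap (d : Order.disp_t) (W : orderType d) (a b : W -> set nat) : Prop :=
  gap a b /\
  forall Gamma : set W, ~ countable Gamma ->
    exists alpha beta, [/\ Gamma alpha, Gamma beta, alpha < beta,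
      a alpha `<=` a beta & b alpha `<=` b beta].

(** * Construction schemes *)

Definition fset_lt (d : Order.disp_t) (W : orderType d) (A B : {fset W}) : Prop :=
  forall x y : W, x \in A -> y \in B -> x < y.

(* A family indexed by the members of [D : set I]; below [I] is omega_1 itself
   or [nat], with [D] an initial segment of it. *)
Definition delta_system (d dI : Order.disp_t) (W : orderType d) (I : orderType dI)
    (D : set I) (s : I -> {fset W}) (root : {fset W}) : Prop :=
  forall i j, D i -> D j -> i < j -> (s i `&` s j)%fset = root.

Definition increasing_delta_system (d dI : Order.disp_t) (W : orderType d)
    (I : orderType dI) (D : set I) (s : I -> {fset W}) (root : {fset W}) : Prop :=
  delta_system D s root /\
  forall i j, D i -> D j -> i < j ->
    fset_lt root (s i `\` root)%fset /\
    fset_lt (s i `\` root)%fset (s j `\` root)%fset.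

(* [n] and [r] are only meaningful at positive indices; their values at [0]
   are irrelevant. *)
Record is_type (m n r : nat -> nat) : Prop := {
  type_m0 : m 0 = 1 ;
  type_r : forall k, (r k.+1 < m k)%N ;
  type_n : forall k, (k.+1 < n k.+1)%N ;
  type_often : forall x, infinite_set [set k | r k.+1 = x] ;
  type_m : forall k, m k.+1 = (n k.+1 * (m k - r k.+1) + r k.+1)%N }.

(* [E] is the union of the members [G 0, ..., G (l - 1)] of [F], all of rank [k]. *)
Definition decomposes (d : Order.disp_t) (W : orderType d) (F : set {fset W})
    (rho : {fset W} -> nat) (k l : nat) (E : {fset W}) (G : nat -> {fset W}) : Prop :=
  (forall i, (i < l)%N -> F (G i) /\ rho (G i) = k) /\
  (forall x : W, x \in E <-> exists i, (i < l)%N /\ x \in G i).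

Definition canonical_decomposition (d : Order.disp_t) (W : orderType d)
    (F : set {fset W}) (rho : {fset W} -> nat) (R : {fset W} -> {fset W})
    (k l : nat) (E : {fset W}) (G : nat -> {fset W}) : Prop :=
  decomposes F rho k l E G /\ increasing_delta_system `I_l G (R E).

(* [rho] and [R] are total functions, but only their values on members of [F]
   are ever used. *)
Record construction_scheme (d : Order.disp_t) (W : orderType d)
    (m n r : nat -> nat) (F : set {fset W})
    (rho : {fset W} -> nat) (R : {fset W} -> {fset W}) : Prop := {
  scheme_cofinal : forall A : {fset W}, exists E, F E /\ (A `<=` E)%fset ;
  scheme_rank0 : forall E, F E -> rho E = 0 -> exists x, E = [fset x]%fset ;
  scheme_card : forall E k, F E -> rho E = k.+1 ->
    #|` E| = m k.+1 /\ #|` R E| = r k.+1 ;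
  (* The order in which the pieces are listed is fixed by the increasing
     Delta-system requirement; uniqueness concerns the collection of pieces, and
     is among all covers of [E] by members of rank [k], not only among those
     that form an increasing Delta-system with root [R E]. *)
  scheme_decomposition : forall E k, F E -> rho E = k.+1 ->
    exists G, canonical_decomposition F rho R k (n k.+1) E G /\
      forall G', decomposes F rho k (n k.+1) E G' ->
        [set G' i | i in `I_(n k.+1)] = [set G i | i in `I_(n k.+1)] ;
  (* Coherence: two members of the same rank meet in an initial segment of
     both.  This clause belongs to Todorcevic's definition of a construction
     scheme and does not follow from the clauses above; without it capturing
     schemes already exist in ZFC. *)
  scheme_coherent : forall E E', F E -> F E' -> rho E = rho E' ->
    forall x y : W, x \in E -> x \in E' -> y \in E -> y < x -> y \in E' }.

(* [phi] restricts to the order-preserving bijection from [A] onto [B]. *)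
Definition order_iso (d : Order.disp_t) (W : orderType d) (A B : {fset W})
    (phi : W -> W) : Prop :=
  {in A &, forall x y, x < y -> phi x < phi y} /\ [fset phi x | x in A]%fset = B.

Definition capturing (d : Order.disp_t) (W : orderType d)
    (n : nat -> nat) (F : set {fset W})
    (rho : {fset W} -> nat) (R : {fset W} -> {fset W}) (N : nat) : Prop :=
  forall (s : W -> {fset W}) (root : {fset W}),
  delta_system [set: W] s root ->
  exists (xi : nat -> W) (E : {fset W}) (k : nat) (G : nat -> {fset W}),
    [/\ forall i j, (i < j < N)%N -> xi i < xi j,
        F E /\ rho E = k.+1,
        (N <= n k.+1)%N /\ canonical_decomposition F rho R k (n k.+1) E G,
        (root `<=` R E)%fset /\
        (s (xi 0) `\` root `<=` G 0 `\` R E)%fset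
      & forall i, (i < N)%N -> exists phi : W -> W,
          [/\ order_iso (G 0) (G i) phi,
              [fset phi x | x in (s (xi 0) `\` root)%fset]%fset
                = (s (xi i) `\` root)%fset
            & (s (xi i) `\` root `<=` G i `\` R E)%fset]].

(** * Forcing *)

Definition compatible (d : Order.disp_t) (P : porderType d) (p q : P) : Prop :=
  exists r : P, r <= p /\ r <= q.

Definition ccc (d : Order.disp_t) (P : porderType d) : Prop :=
  forall A : set P,
    (forall p q, A p -> A q -> p <> q -> ~ compatible p q) -> countable A.

(* [Name u a] is the [P]-name consisting of the pairs (u i, a i), i : X. *)
Inductive name (P : Type) : Type :=
  Name (X : Type) (u : X -> name P) (a : X -> P).

(* Formulas of the forcing language: formulas of set theory with [P]-names as
   parameters; the quantifiers range over all [P]-names. *)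
Inductive formula (P : Type) : Type :=
| fEq (x y : name P)
| fMem (x y : name P)
| fNot (f : formula P)
| fAnd (f g : formula P)
| fImp (f g : formula P)
| fAll (f : name P -> formula P)
| fEx (f : name P -> formula P).

Section Forcing.
Context (d : Order.disp_t) (P : porderType d).

Fixpoint forces_eq (x y : name P) (p : P) {struct x} : Prop :=
  match x, y with
  | @Name _ X u a, @Name _ Y v b =>
      (forall i q, q <= p -> q <= a i ->
         exists r, r <= q /\ exists j, r <= b j /\ forces_eq (u i) (v j) r) /\
      (forall j q, q <= p -> q <= b j ->
         exists r, r <= q /\ exists i, r <= a i /\ forces_eq (u i) (v j) r)
  end.

Definition forces_mem (x y : name P) (p : P) : Prop :=
  match y with
  | @Name _ Y v b =>
      forall q, q <= p ->
        exists r, r <= q /\ exists j, r <= b j /\ forces_eq x (v j) r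
  end.

Fixpoint forces (p : P) (f : formula P) {struct f} : Prop :=
  match f with
  | fEq x y => forces_eq x y p
  | fMem x y => forces_mem x y p
  | fNot g => forall q, q <= p -> ~ forces q g
  | fAnd g h => forces p g /\ forces p h
  | fImp g h => forall q, q <= p -> forces q g -> forces q h
  | fAll g => forall x, forces p (g x)
  | fEx g => forall q, q <= p -> exists r, r <= q /\ exists x, forces r (g x)
  end.

(* Canonical names of ground model objects.  [P] need not have a largest
   element, so the members of a canonical name are paired with all conditions. *)

(* The von Neumann natural number [n]. *)
Fixpoint check_nat (n : nat) : name P :=
  match n with
  | 0 => Name (fun e : False => match e with end) (fun e => match e with end)
  | n.+1 =>
      let: @Name _ X u a := check_nat n in
      Name (fun i : X + P => if i is inl j then u j else check_nat n)
           (fun i : X + P => match i with inl j => a j | inr p => p end)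
  end.

Definition check_set (A : set nat) : name P :=
  Name (fun i : {n : nat | A n} * P => check_nat (sval i.1)) (fun i => i.2).

(* The canonical name of the set {a alpha : alpha}. *)
Definition check_family (W : Type) (a : W -> set nat) : name P :=
  Name (fun i : W * P => check_set (a i.1)) (fun i => i.2).

Definition check_omega : name P := check_set [set: nat].

(* "The subset {x in omega : f x} of omega is finite", i.e. is contained in a
   natural number. *)
Definition finite_formula (f : name P -> formula P) : formula P :=
  fEx (fun k => fAnd (fMem k check_omega)
    (fAll (fun x => fImp (fAnd (fMem x check_omega) (f x)) (fMem x k)))).

(* "There is an infinite subset c of omega such that a \ c is finite for every
   a among the a alpha, and b /\ c is finite for every b among the b alpha." *)
Definition filled_formula (W : Type) (a b : W -> set nat) : formula P :=
  fEx (fun c =>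
    fAnd (fAll (fun x => fImp (fMem x c) (fMem x check_omega)))
   (fAnd (fNot (finite_formula (fun x => fMem x c)))
   (fAnd (fAll (fun A => fImp (fMem A (check_family a))
           (finite_formula (fun x => fAnd (fMem x A) (fNot (fMem x c))))))
        (fAll (fun B => fImp (fMem B (check_family b))
           (finite_formula (fun x => fAnd (fMem x B) (fMem x c)))))))).

End Forcing.

(* Every condition forces that the gap is filled. *)
Definition forces_filled (d dP : Order.disp_t) (W : orderType d) (P : porderType dP)
    (a b : W -> set nat) : Prop :=
  forall p : P, forces p (filled_formula P a b).

(* Main.v *)
(** For [x] and [k], the piece at rank [k + 1] of the scheme that contains [x] has an
   index depending only on the position of [x] in any member of rank [k + 1];
   coherence of the scheme makes that position well defined.  The partial function
   [h x : nat -> bool] sends [k] to the parity of that index, and is undefined when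
   [x] is in the root.  Once [x < y] lie in a common member of the scheme, [h x k] is
   undefined or equal to [h y k] at all later ranks.  Put [2k + h x k] in [a x] and
   [2k + 1 - h x k] in [b x].  Capturing [x, y, z] in the pieces 0, 1, 2 of a member of
   rank [k + 1] gives functions [h] that agree below [k], with values 0, 1, 0 at [k]:
   the pair [x, y] shows that no set fills, and the pair [x, z] is as a T-gap demands.

   To fill a T-gap, order [W] by [x <= y], [a x] included in [a y] and [b x] included
   in [b y], larger being stronger.  The T-gap property is the countable chain
   condition.  Above some [w] all cones are uncountable: otherwise uncountably many points
   have a countable cone, yet each is in the cone of, or at most, a member of a
   maximal, hence countable, antichain of such points.  So among the conditions
   above [w] the generic chain is cofinal, and the union of its [a x] fills the gap. *)

Require Import Defs.
From HB Require Import structures.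
From mathcomp Require Import all_boot all_order.
From mathcomp Require Import finmap.
From mathcomp Require Import boolp classical_sets functions cardinality.
From mathcomp Require Import zify.

Set Implicit Arguments.
Unset Strict Implicit.
Unset Printing Implicit Defensive.

Import Order.TTheory.

Local Open Scope order_scope.
Local Open Scope classical_set_scope.

(** * Finite sets of naturals and countability *)

Lemma finite_nat_boundP (A : set nat) :
  finite_set A <-> exists N, forall x, A x -> (x < N)%N.
Proof.
split=> [/finite_fsetP[X ->]|[N AN]].
  exists (\max_(x <- X) x).+1 => x /= xX.
  by rewrite ltnS (big_rem x)//= leq_maxl.
exact: (@sub_finite_set _ _ `I_N AN (finite_II N)).
Qed.

Lemma infinite_nat_unbounded (A : set nat) N :
  infinite_set A -> exists2 x, A x & (N <= x)%N.
Proof.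
move=> Ainf; apply: contrapT => noA; apply: Ainf.
apply/finite_nat_boundP; exists N => x Ax; rewrite ltnNge.
by apply/negP => Nx; apply: noA; exists x.
Qed.

Lemma uncountable_fiber (T : Type) (V : countType) (f : T -> V) (A : set T) :
  ~ countable A -> exists v, ~ countable [set x | A x /\ f x = v].
Proof.
move=> Auc; apply: contrapT => noV; apply: Auc.
have -> : A = \bigcup_(v in [set: V]) [set x | A x /\ f x = v].
  by apply/seteqP; split=> [x Ax|x [v _ []]//]; exists (f x).
apply: bigcup_countable => [|v _]; first exact: countableP.
by apply: contrapT => vuc; apply: noV; exists v.
Qed.

Lemma countable_setU (T : Type) (A B : set T) :
  countable A -> countable B -> countable (A `|` B).
Proof.
move=> Ac Bc; rewrite -bigcup2E; apply: bigcup_countable => [|i _].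
  exact: countableP.
by case: i => [|[|i]] //=; exact: countable0.
Qed.

(** * Uncountable subsets of the first uncountable ordinal *)

Section Omega1.
Context (d : Order.disp_t) (W : orderType d) (W_omega1 : is_omega1 W).

Lemma omega1_segment_le (x : W) : countable [set y : W | y <= x].
Proof.
have [_ seg _] := W_omega1.
have -> : [set y : W | y <= x] = [set y | y < x] `|` [set x].
  apply/seteqP; split=> y /=.
    by rewrite le_eqVlt => /orP[/eqP ->|]; [right|left].
  by case=> [/ltW|->].
by apply: countable_setU; [exact: seg|exact: countable1].
Qed.

Lemma omega1_unbounded (A : set W) (x : W) :
  ~ countable A -> exists2 y, A y & x < y.
Proof.
move=> Auc; apply: contrapT => noy; apply: Auc.
apply: sub_countable (omega1_segment_le x); apply: subset_card_le => y Ay /=.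
by rewrite leNgt; apply/negP => xy; apply: noy; exists y.
Qed.

(** By recursion [g x] is an element of [A] above all earlier values: these are countably many, so
    the initial segments they bound do not cover [A], and the default of [xget] is never taken. This
    turns an uncountable [Gamma] into a family indexed by [W], as capturing demands. *)
Lemma omega1_enumerate (A : set W) : ~ countable A ->
  exists g : W -> W, (forall x, A (g x)) /\ (forall x y, x < y -> g x < g y).
Proof.
move=> Auc; have [wf seg _] := W_omega1.
pose step x (rec : forall y, y < x -> W) : W :=
  xget x [set z | A z /\ forall y (yx : y < x), rec y yx < z].
pose g := Fix wf (fun _ => W) step.
have gE x : g x = step x (fun y _ => g y).
  apply: (Fix_eq wf (fun _ => W)) => y u v uv; congr (step y _).
  by apply: functional_extensionality_dep => z; apply: functional_extensionality_dep.
have gP x : A (g x) /\ forall y, y < x -> g y < g x.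
  suff zP : exists z, A z /\ forall y, y < x -> g y < z.
    by rewrite gE; exact: (xgetPex x zP).
  apply: contrapT => noz; apply: Auc.
  apply: (@sub_countable _ _ _ (\bigcup_(y in [set y | y < x]) [set z | z <= g y])).
    apply: subset_card_le => z Az; apply: contrapT => zu; apply: noz.
    exists z; split=> // y yx; rewrite ltNge; apply/negP => zy.
    by apply: zu; exists y.
  by apply: bigcup_countable => [|y _]; [exact: seg|exact: omega1_segment_le].
by exists g; split=> [x|x y xy]; [case: (gP x)|case: (gP y) => _; apply].
Qed.

(** * Gaps from coherent partial functions *)

Definition gap_a (h : W -> nat -> option bool) (x : W) : set nat :=
  [set z | h x z./2 = Some (odd z)].

Definition gap_b (h : W -> nat -> option bool) (x : W) : set nat :=
  [set z | h x z./2 = Some (~~ odd z)].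

(** Infinite domains make the sets infinite, and eventual agreement gives the almost inclusions. The
    third hypothesis serves twice, for the T-gap inclusions and against a filling set. *)
Lemma T_gap_of_coherent (h : W -> nat -> option bool) :
  (forall x, infinite_set [set k | h x k <> None]) ->
  (forall x y, x < y -> exists N, forall k, (N <= k)%N ->
     h x k = None \/ h x k = h y k) ->
  (forall Gamma : set W, ~ countable Gamma -> exists x y z k,
     [/\ [/\ Gamma x, Gamma y, Gamma z & x < z],
         forall j, (j < k)%N -> h x j = h y j /\ h x j = h z j,
         [/\ h x k = Some false, h y k = Some true & h z k = Some false]
       & forall j, (k < j)%N -> h x j = None \/ h x j = h z j]) ->
  T_gap (gap_a h) (gap_b h).
Proof.
move=> hinf hcoh hcapt.
have half2 k (e : bool) : (k.*2 + e)./2 = k /\ odd (k.*2 + e) = e.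
  by rewrite addnC half_bit_double oddD odd_double addbF oddb.
have abF x z : gap_a h x z -> ~ gap_b h x z.
  by rewrite /gap_a /gap_b /= => -> []; case: odd.
have ab0 x : gap_a h x `&` gap_b h x = set0.
  by apply/seteqP; split=> // z [/abF].
have sub x y : x < y -> almost_subset (gap_a h x) (gap_a h y) /\
    almost_subset (gap_b h x) (gap_b h y).
  move=> xy; have [N hN] := hcoh _ _ xy.
  have hN' z : (N.*2 <= z)%N -> h x z./2 = None \/ h x z./2 = h y z./2.
    by move=> Nz; apply: hN; lia.
  split; apply/finite_nat_boundP; exists N.*2 => z [az]; rewrite ltnNge;
    by apply: contra_notN => /hN'; rewrite /gap_a /gap_b /= az => -[|<-].
split; last first.
  move=> Gamma /hcapt[x [y [z [k [[Gx Gy Gz xz] lo [hx hy hz] hi]]]]].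
  (* Agreement below [k], the common value at [k] and coherence above it together make [h z] extend
     [h x] everywhere. *)
  have le j : h x j = None \/ h x j = h z j.
    case: (ltngtP j k) => [/lo[_ ->]|/hi|->]; [by right|by []|by right; rewrite hx].
  exists x, z; split=> // t; rewrite /gap_a /gap_b /=;
    by case: (le t./2) => ->.
split.
  split=> //.
  - move=> x; split=> /finite_nat_boundP[N hN];
      have [k hk Nk] := infinite_nat_unbounded N (hinf x);
      case E: (h x k) hk => [e|] // _.
    + have [eh eo] := half2 k e.
      have := hN (k.*2 + e)%N; rewrite /gap_a /= eh eo => /(_ E); lia.
    + have [eh eo] := half2 k (~~ e).
      have := hN (k.*2 + ~~ e)%N; rewrite /gap_b /= eh eo negbK => /(_ E); lia.
  - move=> x y.
    have [xy|yx|->] := ltgtP x y; last by rewrite ab0.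
      have [/finite_nat_boundP[N hN] _] := sub _ _ xy.
      apply/finite_nat_boundP; exists N => z [az bz]; apply: hN; split=> // az'.
      exact: abF az' bz.
    have [_ /finite_nat_boundP[N hN]] := sub _ _ yx.
    apply/finite_nat_boundP; exists N => z [az bz]; apply: hN; split=> // bz'.
    exact: abF az bz'.
move=> [c [_ cfill]].
have bnd x : exists N, forall z, (N <= z)%N ->
    (gap_a h x z -> c z) /\ (gap_b h x z -> ~ c z).
  have [/finite_nat_boundP[N1 h1] /finite_nat_boundP[N2 h2]] := cfill x.
  exists (maxn N1 N2) => z; rewrite geq_max => /andP[z1 z2]; split.
    by move=> az; apply: contrapT => cz; have := h1 z (conj az cz); lia.
  by move=> bz cz; have := h2 z (conj bz cz); lia.
have [N hN] := choice bnd.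
have [_ _ Wuc] := W_omega1.
(* There are only countably many choices of a bound together with a list of values below it, so
   uncountably many points share both. *)
have [[M s] /hcapt] :=
  uncountable_fiber (fun x => (N x, [seq h x k | k <- iota 0 (N x)])) Wuc.
move=> [x [y [_ [k [[[_ [Nx sx]] [_ [Ny sy]] _ _] _ [hx hy _] _]]]]].
(* Below [M] the values of [h x] and [h y] are read from the same list [s], but they differ at
   [k]. *)
have Mk : (M <= k)%N.
  rewrite leqNgt; apply/negP => kM.
  have: nth None s k = nth None s k by [].
  rewrite -{1}sx -sy Nx Ny !(nth_map 0) ?size_iota// !nth_iota// add0n hx hy.
  by [].
(* The number [2k] lies in [gap_a h x] and in [gap_b h y] and is past the common bound, so [c] would
   have to contain and to omit it. *)
have [eh eo] := half2 k false.
have [ca _] := hN x (k.*2 + false)%N ltac:(lia).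
have [_ cb] := hN y (k.*2 + false)%N ltac:(lia).
by apply: cb; [|apply: ca]; rewrite /gap_a /gap_b /= eh eo.
Qed.

End Omega1.

(** * Positions in a construction scheme *)

Lemma cardfsU_disjoint (K : choiceType) (A B : {fset K}) :
  (forall x, x \in A -> x \notin B) -> #|` (A `|` B)%fset| = (#|` A| + #|` B|)%N.
Proof.
move=> AB; rewrite cardfsU (_ : (A `&` B)%fset = fset0) ?cardfs0 ?subn0 //.
by apply/fsetP => x; rewrite !inE; case: (boolP (x \in A)) => // /AB /negbTE.
Qed.

Lemma cardfs_lt (K : choiceType) (A B : {fset K}) (x : K) :
  {subset A <= B} -> x \in B -> x \notin A -> (#|` A| < #|` B|)%N.
Proof.
move=> AB xB xA; apply: fproper_ltn_card; rewrite fproperE.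
by apply/andP; split; [exact/fsubsetP|apply/fsubsetPn; exists x].
Qed.

Definition rank_in (d : Order.disp_t) (W : orderType d) (E : {fset W}) (x : W) : nat :=
  #|` [fset y in E | y < x]%fset|.

Lemma in_below (d : Order.disp_t) (W : orderType d) (E : {fset W}) (x y : W) :
  (y \in [fset z in E | z < x]%fset) = (y \in E) && (y < x).
Proof. by rewrite !inE. Qed.

(** Used to turn the isomorphisms supplied by capturing into equal positions. *)
Lemma rank_in_iso (d : Order.disp_t) (W : orderType d) (A B : {fset W})
    (phi : W -> W) (x : W) :
  order_iso A B phi -> x \in A -> rank_in B (phi x) = rank_in A x.
Proof.
move=> [mono <-] xA; rewrite /rank_in.
have monoE : {in A &, forall y z, (phi y < phi z) = (y < z)}.
  move=> y z yA zA; case: (ltgtP y z) => [yz|zy|->]; last by rewrite ltxx.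
    exact: mono.
  by apply/negbTE; rewrite -leNgt ltW ?mono.
have -> : [fset y in [fset phi z | z in A] | y < phi x]%fset =
    [fset phi z | z in [fset z in A | z < x]]%fset.
  apply/fsetP => y; rewrite !inE; apply/andP/imfsetP => /=.
    move=> [/imfsetP[z /= zA ->] lt]; exists z => //.
    by rewrite !inE zA -monoE.
  move=> [z]; rewrite !inE => /andP[zA zx] ->; rewrite monoE //; split=> //.
  exact: in_imfset.
rewrite card_in_imfset //= => y z; rewrite !inE => /andP[yA _] /andP[zA _] eq.
case: (ltgtP y z) => // lt; have := lt; rewrite -monoE // eq ltxx //.
Qed.

Section Scheme.
Context (d : Order.disp_t) (W : orderType d) (W_omega1 : is_omega1 W).
Context (m n r : nat -> nat) (F : set {fset W}).
Context (rho : {fset W} -> nat) (R : {fset W} -> {fset W}).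
Context (mnr : is_type m n r) (scheme : construction_scheme m n r F rho R).

Lemma type_m_lt k : (m k < m k.+1)%N.
Proof.
rewrite (type_m mnr); have := type_r mnr k; have := type_n mnr k.
move: (n k.+1) (m k) (r k.+1) => N M r' ? ?.
have : (2 * (M - r') <= N * (M - r'))%N by rewrite leq_mul2r; lia.
by lia.
Qed.

Lemma card_scheme E : F E -> #|` E| = m (rho E).
Proof.
move=> FE; case rhoE: (rho E) => [|k].
  by have [x ->] := scheme_rank0 scheme FE rhoE; rewrite cardfs1 (type_m0 mnr).
by have [] := scheme_card scheme FE rhoE.
Qed.

(** Follow the piece containing [x] through [j] successive canonical decompositions. *)
Lemma scheme_descend k j E x : F E -> rho E = (k + j)%N -> x \in E ->
  exists H, [/\ F H, rho H = k, x \in H & {subset H <= E}].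
Proof.
elim: j E => [|j IH] E FE rhoE xE; first by exists E; split=> //; rewrite rhoE addn0.
rewrite addnS in rhoE.
have [G [[[FG EG] _] _]] := scheme_decomposition scheme FE rhoE.
have [i [il xi]] := (EG x).1 xE.
have [FGi rhoGi] := FG i il.
have [H [FH rhoH xH HG]] := IH _ FGi rhoGi xi.
by exists H; split=> // y /HG yG; apply/EG; exists i.
Qed.

Lemma scheme_rank_cover k x : exists E, [/\ F E, rho E = k & x \in E].
Proof.
have [_ _ Wuc] := W_omega1.
(* A member with more than [m k] elements cannot have rank below [k], since [m] increases; from it
   one descends to rank [k]. *)
have [|B _ cB] := @infinite_set_fset _ [set: W] (m k).+1.
  by move=> /finite_set_countable.
have [E [FE]] := scheme_cofinal scheme (x |` B)%fset.
rewrite fsubUset fsub1set => /andP[xE /fsubset_leq_card BE].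
have kE : (k <= rho E)%N.
  rewrite leqNgt; apply/negP => Ek.
  have : (m (rho E) <= m k)%N.
    apply: (@homo_leq _ m leq leqnn leq_trans) => [i|]; first exact/ltnW/type_m_lt.
    exact: ltnW.
  by rewrite -card_scheme //; lia.
have [|H [FH rhoH xH _]] := @scheme_descend k (rho E - k) E x FE _ xE; first lia.
by exists H.
Qed.

Definition pos k x : nat :=
  rank_in (xget fset0 [set E | [/\ F E, rho E = k & x \in E]]) x.

(** By coherence, two members of the same rank containing [x] have the same elements below [x], so
    the member chosen in [pos] is immaterial. *)
Lemma posE E x : F E -> x \in E -> pos (rho E) x = rank_in E x.
Proof.
move=> FE xE.
have := xgetPex fset0 (scheme_rank_cover (rho E) x).
rewrite /pos; move: (xget _ _) => E' [FE' rhoE' xE'].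
rewrite /rank_in; congr #|` _|; apply/fsetP => y; rewrite !inE.
apply/andP/andP => -[yE yx]; split=> //.
  exact: (scheme_coherent scheme FE' FE rhoE' xE').
exact: (scheme_coherent scheme FE FE' (esym rhoE') xE).
Qed.

(** Descend inside [H] to a member of the rank of [E] that contains [y]; coherence with [E] brings
    [x] into it. *)
Lemma scheme_together E H x y : F E -> F H -> (rho E <= rho H)%N ->
  x \in E -> y \in E -> y \in H -> x < y -> x \in H.
Proof.
move=> FE FH EH xE yE yH xy.
have [|H' [FH' rhoH' yH' sub]] := @scheme_descend (rho E) (rho H - rho E) H y FH _ yH.
  lia.
apply: sub; exact: (scheme_coherent scheme FE FH' (esym rhoH') yE).
Qed.

(** * Positions within a canonical decomposition *)

Section Decomposition.
Context (k : nat) (E : {fset W}) (G : nat -> {fset W}).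
Context (FE : F E) (rhoE : rho E = k.+1).
Context (dec : canonical_decomposition F rho R k (n k.+1) E G).

Let M := (m k - r k.+1)%N.

Let n_gt1 : (1 < n k.+1)%N.
Proof. by have := type_n mnr k; lia. Qed.

Let M_gt0 : (0 < M)%N.
Proof. by rewrite subn_gt0; exact: type_r mnr k. Qed.

Lemma piece_sub i : (i < n k.+1)%N -> {subset G i <= E}.
Proof. by move=> il x xi; apply/dec.1.2; exists i. Qed.

Lemma piece_delta i j : (i < j < n k.+1)%N -> (G i `&` G j)%fset = R E.
Proof.
move=> /andP[ij jl]; have [_ [delta _]] := dec.
by apply: delta; rewrite ?ltEnat //=; exact: ltn_trans jl.
Qed.

Lemma piece_increasing i j : (i < j < n k.+1)%N ->
  fset_lt (R E) (G i `\` R E)%fset /\ fset_lt (G i `\` R E)%fset (G j `\` R E)%fset.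
Proof.
move=> /andP[ij jl]; have [_ [_ inc]] := dec.
by apply: inc; rewrite ?ltEnat //=; exact: ltn_trans jl.
Qed.

Lemma root_sub i : (i < n k.+1)%N -> (R E `<=` G i)%fset.
Proof.
case: i => [|i] il.
  by rewrite -(@piece_delta 0 1) ?fsubsetIl.
by rewrite -(@piece_delta 0 i.+1) ?fsubsetIr.
Qed.

Lemma card_piece i : (i < n k.+1)%N -> #|` (G i `\` R E)%fset| = M.
Proof.
move=> il; rewrite cardfsDS ?root_sub //.
have [FG rhoG] := dec.1.1 i il.
by rewrite card_scheme // rhoG (scheme_card scheme FE rhoE).2.
Qed.

(** The definition of an increasing system compares the root with a piece only if a later piece
    follows. The last piece is reached through a point of piece 0. *)
Lemma root_lt i x y : (i < n k.+1)%N ->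
  x \in R E -> y \in (G i `\` R E)%fset -> x < y.
Proof.
move=> il xR yi.
have [z z0] : exists z, z \in (G 0 `\` R E)%fset.
  by apply/fset0Pn; rewrite -cardfs_gt0 card_piece //; lia.
have [rt _] := @piece_increasing 0 1 n_gt1.
case: i il yi => [|i] il yi; first exact: rt.
have [_ lt0] := @piece_increasing 0 i.+1 il.
exact: lt_trans (rt _ _ xR z0) (lt0 _ _ z0 yi).
Qed.

Lemma piece_lt i j x y : (i < j < n k.+1)%N ->
  x \in (G i `\` R E)%fset -> y \in (G j `\` R E)%fset -> x < y.
Proof.
by move=> /piece_increasing[_]; apply.
Qed.

(** The root precedes all other points, so it is an initial segment of [E] and of every piece. *)
Lemma rank_in_root i x : (i < n k.+1)%N -> x \in R E ->
  rank_in (G i) x = rank_in E x /\ (rank_in E x < r k.+1)%N.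
Proof.
move=> il xR.
have below y : (y \in E) && (y < x) -> y \in R E.
  move=> /andP[/dec.1.2[j [jl yj]] yx]; apply/negPn/negP => yR.
  have : x < y by apply: (root_lt jl xR); rewrite !inE yR.
  by rewrite ltNge ltW.
split.
  rewrite /rank_in; congr #|` _|; apply/fsetP => y; rewrite !inE.
  apply/andP/andP => -[yE yx]; split=> //; first exact: piece_sub yE.
  by apply: (fsubsetP (root_sub il)); apply: below; rewrite yE.
rewrite -(scheme_card scheme FE rhoE).2; apply: (@cardfs_lt _ _ _ x) => //.
  by move=> y; rewrite !inE => /below.
by rewrite !inE ltxx andbF.
Qed.

(** [E] is the root followed by consecutive blocks of length [M], the pieces without the root; [t]
    is the offset of [x] in its block. *)
Lemma rank_in_piece i x : (i < n k.+1)%N -> x \in (G i `\` R E)%fset ->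
  exists t, [/\ (t < M)%N, rank_in (G i) x = (r k.+1 + t)%N &
    rank_in E x = (r k.+1 + i * M + t)%N].
Proof.
move=> il xi; pose T := [fset y in (G i `\` R E) | y < x]%fset.
have cR := (scheme_card scheme FE rhoE).2.
have TP y : y \in T = [&& y \notin R E, y \in G i & y < x] by rewrite !inE andbA.
exists #|` T|; split.
- rewrite -(card_piece il); apply: (@cardfs_lt _ _ _ x) => // [y|].
    by rewrite TP inE => /and3P[-> ->].
  by rewrite TP ltxx !andbF.
- rewrite -cR -cardfsU_disjoint /rank_in; last first.
    by move=> y yR; rewrite TP yR.
  congr #|` _|; apply/fsetP => y; rewrite in_fsetU TP in_below.
  have [yR|yR] /= := boolP (y \in R E); last by [].
  by rewrite (root_lt il yR xi) (fsubsetP (root_sub il) _ yR).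
(* [U j] is the root with the first [j] blocks; the points of [E] below [x] are those of [U i] and
   of [T]. *)
pose U := fix U j := if j is j'.+1 then (U j' `|` (G j' `\` R E))%fset else R E.
have UP j y : reflect (y \in R E \/ exists2 l, (l < j)%N & y \in (G l `\` R E)%fset)
    (y \in U j).
  apply: (iffP idP); elim: j => [|j IH] /=.
  - by left.
  - rewrite in_fsetU => /orP[/IH[|[l lj yl]]|yj]; [by left| |].
      by right; exists l => //; lia.
    by right; exists j.
  - by move=> [//|[]].
  - rewrite in_fsetU; move=> [yR|[l lj yl]]; first by rewrite IH //; left.
    have [jl|] := leqP j l; last by move=> lj'; rewrite IH //; right; exists l.
    have -> : j = l by lia.
    by rewrite yl orbT.
have disj l j y : (l < j < n k.+1)%N -> y \in (G l `\` R E)%fset ->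
    y \notin (G j `\` R E)%fset.
  by move=> lj yl; apply/negP => yj; have := piece_lt lj yl yj; rewrite ltxx.
have cU j : (j <= n k.+1)%N -> #|` U j| = (r k.+1 + j * M)%N.
  elim: j => [|j IH] jl /=; first by rewrite cR; lia.
  rewrite cardfsU_disjoint ?IH ?card_piece //; try lia.
  by move=> y /UP[yR|[l lj /disj]]; [rewrite !inE yR|apply; lia].
rewrite -cU ?(ltnW il) // -cardfsU_disjoint; last first.
  move=> y /UP[yR|[l lj yl]]; first by rewrite TP yR.
  have: y \notin (G i `\` R E)%fset by apply: disj yl; lia.
  by rewrite TP !inE; apply: contra => /and3P[-> ->].
rewrite /rank_in; congr #|` _|; apply/fsetP => y; rewrite in_fsetU TP in_below.
apply/andP/orP.
  move=> [/dec.1.2[j [jl yj]] yx].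
  have [yR|yR] := boolP (y \in R E); first by left; apply/UP; left.
  have yjR : y \in (G j `\` R E)%fset by rewrite inE yR.
  case: (ltngtP j i) => ji.
  - by left; apply/UP; right; exists j.
  - have := piece_lt _ xi yjR; rewrite ji jl => /(_ isT).
    by rewrite ltNge ltW.
  - by right; rewrite -ji yj yx.
move=> [/UP[yR|[l lj yl]]|/and3P[yR yi yx]].
- by rewrite (root_lt il yR xi) (piece_sub il) // (fsubsetP (root_sub il)).
- rewrite (piece_lt _ yl xi) ?lj //; split=> //.
  by move: yl; rewrite inE => /andP[_]; apply: piece_sub; lia.
- by rewrite yx (piece_sub il).
Qed.

End Decomposition.

(** * The coherent functions of a capturing scheme *)

(** This is [h x]: the first [r k.+1] positions belong to the root, and for the others the quotient
    by the block length is the index of the piece. *)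
Definition piece_parity x k : option bool :=
  if (pos k.+1 x < r k.+1)%N then None
  else Some (odd ((pos k.+1 x - r k.+1) %/ (m k - r k.+1))).

(** Passing from [E] to the piece containing [x] keeps the offset and forgets the index of the
    block. *)
Lemma pos_step k x : pos k x =
  if (pos k.+1 x < r k.+1)%N then pos k.+1 x
  else (r k.+1 + (pos k.+1 x - r k.+1) %% (m k - r k.+1))%N.
Proof.
have [E [FE rhoE xE]] := scheme_rank_cover k.+1 x.
have [G [dec _]] := scheme_decomposition scheme FE rhoE.
rewrite -rhoE posE // rhoE.
have [i [il xi]] := (dec.1.2 x).1 xE.
have [FG rhoG] := dec.1.1 i il.
rewrite -{1}rhoG posE //.
have [xR|xR] := boolP (x \in R E).
  by have [-> ->] := rank_in_root FE rhoE dec il xR.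
have [|t [tM -> ->]] := rank_in_piece FE rhoE dec il (x := x); first by rewrite inE xR.
rewrite ltnNge -addnA leq_addr /= addKn modnMDl modn_small //.
Qed.

(** The position at rank [k] determines all positions at lower ranks, and the value at [j] depends
    only on the position at rank [j.+1]. *)
Lemma piece_parity_pos k x y : pos k x = pos k y ->
  forall j, (j < k)%N -> piece_parity x j = piece_parity y j.
Proof.
elim: k => // k IH eq_pos j.
rewrite ltnS leq_eqVlt => /orP[/eqP ->|]; first by rewrite /piece_parity eq_pos.
by apply: IH; rewrite (pos_step k x) (pos_step k y) eq_pos.
Qed.

Lemma piece_parity_root k E x : F E -> rho E = k.+1 -> x \in R E ->
  piece_parity x k = None.
Proof.
move=> FE rhoE xR; have [G [dec _]] := scheme_decomposition scheme FE rhoE.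
have n0 : (0 < n k.+1)%N by have := type_n mnr k; lia.
have xE : x \in E.
  by apply: (piece_sub dec n0); apply: (fsubsetP (root_sub rhoE dec n0)).
rewrite /piece_parity -rhoE posE // rhoE.
by have [_ ->] := rank_in_root FE rhoE dec n0 xR.
Qed.

Lemma piece_parity_piece k E G i x : F E -> rho E = k.+1 ->
  canonical_decomposition F rho R k (n k.+1) E G -> (i < n k.+1)%N ->
  x \in (G i `\` R E)%fset -> piece_parity x k = Some (odd i).
Proof.
move=> FE rhoE dec il xi.
have xE : x \in E by move: xi; rewrite inE => /andP[_ /(piece_sub dec il)].
rewrite /piece_parity -rhoE posE // rhoE.
have [t [tM _ ->]] := rank_in_piece FE rhoE dec il xi.
rewrite ltnNge -addnA leq_addr /= addKn divnMDl; last by lia.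
by rewrite divn_small // addn0.
Qed.

(** In a member of rank [k.+1] containing [y], the piece of [y] has rank at least that of [E], so it
    contains [x] as well. Either [x] is in the root, or neither point is, the root being an initial
    segment. *)
Lemma piece_parity_coherent E k x y : F E -> (rho E <= k)%N ->
  x \in E -> y \in E -> x < y ->
  piece_parity x k = None \/ piece_parity x k = piece_parity y k.
Proof.
move=> FE Ek xE yE xy.
have [H [FH rhoH yH]] := scheme_rank_cover k.+1 y.
have [G [dec _]] := scheme_decomposition scheme FH rhoH.
have [i [il yi]] := (dec.1.2 y).1 yH.
have [FG rhoG] := dec.1.1 i il.
have xi : x \in G i.
  by apply: (scheme_together FE FG _ xE yE yi xy); rewrite rhoG.
have [xR|xR] := boolP (x \in R H).
  by left; exact: piece_parity_root xR.
have xiR : x \in (G i `\` R H)%fset by rewrite inE xR.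
have yiR : y \in (G i `\` R H)%fset.
  rewrite inE yi andbT; apply/negP => yR.
  have := root_lt FH rhoH dec il yR xiR.
  by rewrite ltNge ltW.
by right; rewrite (piece_parity_piece FH rhoH dec il xiR)
  (piece_parity_piece FH rhoH dec il yiR).
Qed.

Lemma T_gap_of_scheme : capturing n F rho R 3 ->
  T_gap (gap_a piece_parity) (gap_b piece_parity).
Proof.
move=> capt; apply: (T_gap_of_coherent W_omega1).
(* Whenever the root is empty the function is defined, and a type has [r] equal to 0 infinitely
   often. *)
- move=> x fin; apply: (@type_often _ _ _ mnr 0); apply: sub_finite_set fin => k /= rk.
  by rewrite /piece_parity rk ltn0.
- move=> x y xy; have [E [FE]] := scheme_cofinal scheme [fset x; y]%fset.
  rewrite fsubUset !fsub1set => /andP[xE yE].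
  by exists (rho E) => k Ek; exact: piece_parity_coherent FE Ek xE yE xy.
(* Capturing is applied to the singletons of an enumeration of part of [Gamma], a system with empty
   root. *)
move=> Gamma /(omega1_enumerate W_omega1)[g [gG gmono]].
have delta : delta_system [set: W] (fun x => [fset g x]%fset) fset0.
  move=> x y _ _ /gmono; rewrite /= => lt; apply/fsetP => z; rewrite !inE.
  by apply/negP => /andP[/eqP -> /eqP eq]; rewrite eq ltxx in lt.
have [xi [E [k [G [ximono [FE rhoE] [n3 dec] _ phiP]]]]] := capt _ _ delta.
have xiG i : (i < 3)%N -> g (xi i) \in (G i `\` R E)%fset /\
    pos k (g (xi i)) = pos k (g (xi 0)).
  move=> i3; have [phi [iso]] := phiP i i3.
  rewrite !fsetD0 => /fsetP/(_ (g (xi i))).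
  rewrite !inE eqxx => /imfsetP[z /=]; rewrite inE => /eqP -> gE.
  rewrite fsub1set => iG; split; first by move: iG; rewrite !inE.
  have [FG0 rhoG0] := dec.1.1 0 ltac:(lia).
  have [FGi rhoGi] := dec.1.1 i ltac:(lia).
  have [_ [_ _]] := phiP 0 isT; rewrite fsetD0 fsub1set => G0.
  move: iG G0; rewrite !inE => /andP[_ iG] /andP[_ zG].
  by rewrite -{1}rhoGi posE // -rhoG0 posE // gE (rank_in_iso iso).
have [x0 _] := xiG 0 isT; have [x1 p1] := xiG 1 isT; have [x2 p2] := xiG 2 isT.
exists (g (xi 0)), (g (xi 1)), (g (xi 2)), k; split.
- by split=> //; apply: gmono; apply: ximono.
- by move=> j jk; split; apply: piece_parity_pos jk.
- have par i (i3 : (i < 3)%N) := piece_parity_piece FE rhoE dec (leq_trans i3 n3).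
  by split; [exact: par x0|exact: par x1|exact: par x2].
have inE i : (i < 3)%N -> g (xi i) \in E.
  move=> i3; have [] := xiG i i3; rewrite in_fsetD => /andP[_].
  by move=> /(piece_sub dec) h _; apply: h; lia.
move=> j kj; apply: (piece_parity_coherent FE); rewrite ?rhoE ?inE //.
by apply: gmono; apply: ximono.
Qed.

End Scheme.

(** * Forcing with a cone of a T-gap *)

Section Forces.
Context (d : Order.disp_t) (P : porderType d).
Implicit Types (x y z : name P) (p q : P).

Lemma forces_eq_le x y p q : q <= p -> forces_eq x y p -> forces_eq x y q.
Proof.
case: x y => X u a [Y v b] qp /= [xy yx].
by split=> [i|j] s sq; [apply: xy|apply: yx]; exact: le_trans qp.
Qed.

Lemma forces_eq_refl x p : forces_eq x x p.
Proof.
elim: x p => X u IH a p /=; split=> i q qp qi; exists q; split=> //; exists i; split=> //;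
  exact: IH.
Qed.

Lemma forces_eq_sym x y p : forces_eq x y p -> forces_eq y x p.
Proof.
elim: x y p => X u IH a [Y v b] p /= [xy yx]; split=> [j|i] q qp qj.
  have [s [sq [i [si eq]]]] := yx j q qp qj.
  by exists s; split=> //; exists i; split=> //; apply: IH.
have [s [sq [j [sj eq]]]] := xy i q qp qj.
by exists s; split=> //; exists j; split=> //; apply: IH.
Qed.

Lemma forces_eq_trans x y z p : forces_eq x y p -> forces_eq y z p -> forces_eq x z p.
Proof.
elim: x y z p => X u IH a [Y v b] [Z w c] p /= [xy yx] [yz zy].
split=> [i|k] q qp qi.
  have [s [sq [j [sj eq]]]] := xy i q qp qi.
  have [t [ts [k [tk eq']]]] := yz j s (le_trans sq qp) sj.
  exists t; split; first exact: le_trans sq.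
  by exists k; split=> //; apply: IH eq'; apply: forces_eq_le eq.
have [s [sq [j [sj eq]]]] := zy k q qp qi.
have [t [ts [i [ti eq']]]] := yx j s (le_trans sq qp) sj.
exists t; split; first exact: le_trans sq.
by exists i; split=> //; apply: IH eq' _; apply: forces_eq_le eq.
Qed.

Lemma forces_mem_le x y p q : q <= p -> forces_mem x y p -> forces_mem x y q.
Proof. by case: y => Y v b qp h s sq; apply: h; exact: le_trans qp. Qed.

Lemma forces_mem_eql x y z p : forces_eq x y p -> forces_mem y z p -> forces_mem x z p.
Proof.
case: z => Z w c xy h q qp; have [s [sq [k [sk eq]]]] := h q qp.
exists s; split=> //; exists k; split=> //; apply: forces_eq_trans eq.
by apply: forces_eq_le xy; exact: le_trans qp.
Qed.

Lemma forces_mem_eqr x y z p : forces_mem x y p -> forces_eq y z p -> forces_mem x z p.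
Proof.
case: y z => Y v b [Z w c] h [yz _] q qp.
have [s [sq [j [sj eq]]]] := h q qp.
have [t [ts [k [tk eq']]]] := yz j s (le_trans sq qp) sj.
exists t; split; first exact: le_trans sq.
by exists k; split=> //; apply: forces_eq_trans eq'; apply: forces_eq_le eq.
Qed.

Lemma forces_memT x y p :
  (forall q, q <= p -> exists2 s, s <= q & forces_mem x y s) -> forces_mem x y p.
Proof.
case: y => Y v b h q qp; have [s sq hs] := h q qp.
have [t [ts ht]] := hs s (lexx s); exists t; split=> //; exact: le_trans sq.
Qed.

Lemma forces_mem_check_nat x n p : forces_mem x (check_nat P n) p <->
  forall q, q <= p -> exists s i, [/\ s <= q, (i < n)%N & forces_eq x (check_nat P i) s].
Proof.
elim: n p => [|n IH] p /=.
  by split=> h q /h; [move=> [s [_ []]]|move=> [s [i []]]].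
(* Members of the name of [n.+1] are those of [n], tagged [inl], and [n] itself, tagged [inr]. *)
move: IH; case E : (check_nat P n) => [X u a] IH; rewrite -E; split.
  move=> h q qp; have [s [sq [[j|p'] [sj eq]]]] := h q qp; last first.
    by exists s, n; split=> //.
  have [|t [i [ts il eq']]] := (IH s).1 _ s (lexx s).
    move=> q' q's; exists q'; split=> //; exists j; split; first exact: le_trans sj.
    exact: forces_eq_le eq.
  by exists t, i; split=> //; [exact: le_trans sq|exact: ltnW].
move=> h q qp; have [s [i [sq il eq]]] := h q qp.
have [ilt|] := ltnP i n; last first.
  move=> ni; exists s; split=> //; exists (inr s); split=> //.
  by rewrite (_ : n = i) //; lia.
have [|t [ts [j [tj eq']]]] := (IH s).2 _ s (lexx s).
  by move=> q' q's; exists q', i; split=> //; exact: forces_eq_le eq.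
by exists t; split; [exact: le_trans sq|exists (inl j)].
Qed.

(** If [l < k] were forced equal, then [l], a member of [k], would be a member of itself, hence
    equal to some smaller number, against the induction hypothesis. *)
Lemma forces_eq_check_nat i j p : forces_eq (check_nat P i) (check_nat P j) p -> i = j.
Proof.
have lt_absurd l k q : (l < k)%N -> ~ forces_eq (check_nat P l) (check_nat P k) q.
  elim/ltn_ind: k l q => k IH l q lk eq.
  have mem : forces_mem (check_nat P l) (check_nat P k) q.
    apply/forces_mem_check_nat => s sq; exists s, l; split=> //.
    exact: forces_eq_refl.
  have := forces_mem_eqr mem (forces_eq_sym eq).
  move=> /forces_mem_check_nat/(_ q (lexx q))[s [i' [_ il /forces_eq_sym]]].
  exact: IH.
by case: (ltngtP i j) => // ij eq; case: (lt_absurd _ _ p ij) => //; exact: forces_eq_sym.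
Qed.

Lemma forces_le (f : formula P) p q : q <= p -> forces p f -> forces q f.
Proof.
elim: f p q => [x y|x y|f IH|f IHf g IHg|f IHf g IHg|f IH|f IH] p q qp /=.
- exact: forces_eq_le.
- exact: forces_mem_le.
- by move=> h s sq; apply: h; exact: le_trans qp.
- by move=> [hf hg]; split; [exact: IHf hf|exact: IHg hg].
- by move=> h s sq; apply: h; exact: le_trans qp.
- by move=> h x; apply: IH (h x).
- by move=> h s sq; apply: h; exact: le_trans qp.
Qed.

Lemma check_set_witness x A p : forces_mem x (check_set P A) p ->
  exists q n, [/\ q <= p, A n & forces_eq x (check_nat P n) q].
Proof.
by move=> /(_ p (lexx p))[q [qp [[[n An] s] /= [qs eq]]]]; exists q, n.
Qed.

Lemma forces_mem_check_set n A p :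
  A n -> forces_mem (check_nat P n) (check_set P A) p.
Proof.
move=> An q qp; exists q; split; first exact: lexx.
by exists (exist _ n An, q); split; [exact: lexx|exact: forces_eq_refl].
Qed.

(** The form in which both finiteness clauses of the filling formula are checked: a bound [N] need
    only be found densely, and membership below it need only be decided densely. *)
Lemma forces_finite (f : name P -> formula P) p :
  (forall q, q <= p -> exists s N, s <= q /\ forall x t, t <= s -> forces t (f x) ->
     exists u n, [/\ u <= t, (n < N)%N & forces_eq x (check_nat P n) u]) ->
  forces p (finite_formula f).
Proof.
move=> fN q /fN[s [N [sq hN]]]; exists s; split=> //.
exists (check_nat P N); split; first exact: forces_mem_check_set.
move=> x t ts [_ fx]; apply/forces_mem_check_nat => u ut.
by apply: hN; [exact: le_trans ts|exact: forces_le fx].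
Qed.

End Forces.

(** * The order given by a gap and its cones *)

(** The conjunct [x <= y] secures antisymmetry, even if different indices carry the same sets. *)
Definition extends (d : Order.disp_t) (W : orderType d) (a b : W -> set nat)
    (x y : W) : bool :=
  `[< [/\ x <= y, a x `<=` a y & b x `<=` b y] >].

Lemma extends_refl (d : Order.disp_t) (W : orderType d) (a b : W -> set nat) :
  reflexive (extends a b).
Proof. by move=> x; apply/asboolP; split. Qed.

Lemma extends_trans (d : Order.disp_t) (W : orderType d) (a b : W -> set nat) :
  transitive (extends a b).
Proof.
move=> y x z /asboolP[xy axy bxy] /asboolP[yz ayz byz]; apply/asboolP.
by split; [exact: le_trans yz|exact: subset_trans ayz|exact: subset_trans byz].
Qed.

Lemma extends_anti (d : Order.disp_t) (W : orderType d) (a b : W -> set nat) :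
  antisymmetric (extends a b).
Proof.
move=> x y /andP[/asboolP[xy _ _] /asboolP[yx _ _]].
by apply/le_anti; rewrite xy.
Qed.

Definition cone (d : Order.disp_t) (W : orderType d) (a b : W -> set nat) (w : W) :=
  {x : W | extends a b w x}.

Section Cone.
Context (d : Order.disp_t) (W : orderType d) (a b : W -> set nat) (w : W).

HB.instance Definition _ := Choice.on (cone a b w).

Definition cone_le (p q : cone a b w) : bool := extends a b (val q) (val p).

Fact cone_le_refl : reflexive cone_le.
Proof. by move=> p; exact: extends_refl. Qed.

Fact cone_le_anti : antisymmetric cone_le.
Proof.
by move=> p q pq; apply/val_inj/(@extends_anti _ _ a b); rewrite andbC.
Qed.

Fact cone_le_trans : transitive cone_le.
Proof. by move=> q p r pq qr; exact: extends_trans pq. Qed.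

HB.instance Definition _ := Order.Le_isPOrder.Build d (cone a b w)
  cone_le_refl cone_le_anti cone_le_trans.

End Cone.

(** * The countable chain condition and the generic filling *)

Section GapForcing.
Context (d : Order.disp_t) (W : orderType d) (W_omega1 : is_omega1 W).
Context (a b : W -> set nat) (Tab : T_gap a b).

Lemma exists_uncountable_cone :
  exists w, forall x, extends a b w x -> ~ countable [set y | extends a b x y].
Proof.
have [_ seg Wuc] := W_omega1; have [_ Tcmp] := Tab.
apply: contrapT => noW.
pose Q := [set x | countable [set y | extends a b x y]].
have Quc : ~ countable Q.
  move=> Qc; apply: Wuc.
  apply: (@sub_countable _ _ _ (\bigcup_(x in Q) [set y | y <= x])); last first.
    by apply: bigcup_countable => // x _; exact: omega1_segment_le.
  apply: subset_card_le => w _; apply: contrapT => wQ; apply: noW; exists w => x wx xc.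
  by apply: wQ; exists x => //=; case/asboolP: wx.
(* Zorn gives a maximal antichain for [extends] inside [Q]; the T-gap property makes it
   countable. *)
pose anti (A : set W) := A `<=` Q /\
  forall x y, A x -> A y -> extends a b x y -> x = y.
have [|A [[AQ Aanti] Amax]] := @Zorn_bigcup _ anti.
  move=> C Canti Ctot; split=> [x [A CA]|x y [A CA Ax] [B CB By]].
    by have [AQ _] := Canti _ CA; exact: AQ.
  case: (Ctot _ _ CA CB) => [AB|BA].
    by have [_] := Canti _ CB; apply=> //; exact: AB.
  by have [_] := Canti _ CA; apply=> //; exact: BA.
have Ac : countable A.
  apply: contrapT => /Tcmp[x [y [Ax Ay xy axy bxy]]].
  have : x = y by apply: Aanti => //; apply/asboolP; split=> //; exact: ltW.
  by move=> eq; rewrite eq ltxx in xy.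
apply: Quc; apply: (@sub_countable _ _ _ (\bigcup_(x in A)
    ([set y | extends a b x y] `|` [set y | y <= x]))); last first.
  apply: bigcup_countable => // x /AQ xc.
  by apply: countable_setU => //; exact: omega1_segment_le.
(* A point outside this union is comparable with no member of [A], so adding it would contradict
   maximality. *)
apply: subset_card_le => x Qx; apply: contrapT => xA.
apply: (Amax (A `|` [set x])).
  split; first exact: subsetUl.
  move=> sub; apply: xA; exists x; first by apply: sub; right.
  by left; exact: extends_refl.
have noext y : A y -> extends a b x y \/ extends a b y x -> False.
  move=> Ay [/asboolP[xy _ _]|yx]; apply: xA; exists y => //; first by right.
  by left.
split=> [y [/AQ//|-> //]|y z [Ay|->] [Az|->]] //.
- exact: Aanti.
- by move=> yx; case: (noext y Ay); right.
- by move=> xz; case: (noext z Az); left.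
Qed.

Context (w : W).
Context (wP : forall x, extends a b w x -> ~ countable [set y | extends a b x y]).

Local Notation P := (cone a b w).

(** Of two indices related by the T-gap property, the larger is a common extension of both. *)
Lemma cone_ccc : ccc P.
Proof.
move=> A anti; apply: contrapT => Auc; have [_ Tcmp] := Tab.
have [|x [y [[p Ap <-] [q Aq <-] pq apq bpq]]] := Tcmp (val @` A).
  move=> cA; apply: Auc; move: cA; rewrite (eq_countable (inj_card_eq _)) // => p q _ _.
  exact: val_inj.
apply: (anti p q) => //.
  by move=> eq; rewrite eq ltxx in pq.
exists q; split; last exact: lexx.
by apply/asboolP; split=> //; exact: ltW.
Qed.

(** This is the density that makes the generic chain cofinal in [W]. *)
Lemma cone_unbounded (p : P) (x : W) : exists2 q : P, q <= p & x < val q.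
Proof.
have [y py xy] := omega1_unbounded W_omega1 x (wP (valP p)).
have wy : extends a b w y := extends_trans (valP p) py.
by exists (exist _ y wy).
Qed.

Lemma cone_le_a (p q : P) : q <= p -> a (val p) `<=` a (val q).
Proof. by case/asboolP. Qed.

Lemma cone_le_b (p q : P) : q <= p -> b (val p) `<=` b (val q).
Proof. by case/asboolP. Qed.

(* Pairing every element of [a (val p)] with [p] names the union of the [a x] over
   the generic chain. *)
Definition generic_union : name P :=
  Name (fun i : {i : nat * P | a (val i.2) i.1} => check_nat P (sval i).1)
       (fun i => (sval i).2).

Lemma forces_mem_generic_union n (p : P) :
  a (val p) n -> forces_mem (check_nat P n) generic_union p.
Proof.
move=> an q qp; exists q; split; first exact: lexx.
exists (exist (fun i : nat * P => a (val i.2) i.1) (n, p) an); split=> //.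
exact: forces_eq_refl.
Qed.

Lemma generic_union_witness x (p : P) : forces_mem x generic_union p ->
  exists q n, [/\ q <= p, a (val q) n & forces_eq x (check_nat P n) q].
Proof.
move=> /(_ p (lexx p))[q [qp [[[n s] /= an] [qs eq]]]].
by exists q, n; split=> //; exact: cone_le_a an.
Qed.

Lemma cone_forces_filled : forces_filled P a b.
Proof.
have [[[inf ab0 sub _] _] _] := Tab.
move=> p0 p _; exists p; split; first exact: lexx.
exists generic_union; split; [|split; [|split]].
- move=> x q qp xc; apply: forces_memT => s sq.
  have [t [n [ts _ eq]]] := generic_union_witness (forces_mem_le sq xc).
  by exists t => //; apply: forces_mem_eql eq _; exact: forces_mem_check_set.
(* If [q] forced a bound, some [t] would fix it as [N]; but [a (val t)] has elements beyond [N],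
   which [t] forces into the union. *)
- move=> q qp /(_ q (lexx q))[s [sq [k [kN kP]]]].
  have [t [N [ts _ eq]]] := check_set_witness kN.
  have [n an Nn] := infinite_nat_unbounded N (inf (val t)).1.
  have nk : forces_mem (check_nat P n) k t.
    apply: (kP (check_nat P n) t ts); split; first exact: forces_mem_check_set.
    exact: forces_mem_generic_union.
  have := forces_mem_eqr nk eq.
  move=> /forces_mem_check_nat/(_ t (lexx t))[u [i [_ iN /forces_eq_check_nat ni]]].
  by rewrite -ni ltnNge Nn in iN.
- move=> A q qp Aa.
  apply: (@forces_finite _ _ (fun y => fAnd (fMem y A) (fNot (fMem y generic_union)))).
  move=> s sq.
  have [t [ts [[x ?] [_ Ax]]]] := Aa s sq.
  (* Once a condition [u] passes [x], all of [a (val u)] is in the union, so only the finite set of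
     points of [a x] outside [a (val u)] can be missing. *)
  have [u ut xu] := cone_unbounded t x.
  have [/finite_nat_boundP[N hN] _] := sub _ _ xu.
  exists u, N; split; first exact: le_trans ts.
  move=> y v vu [yA ync].
  have eqA := forces_eq_le (le_trans vu ut) Ax.
  have [v' [n [v'v an eq]]] := check_set_witness (forces_mem_eqr yA eqA).
  exists v', n; split=> //; apply: hN; split=> // anu.
  apply: (ync v' v'v); apply: forces_mem_eql eq _.
  apply: forces_mem_generic_union; exact: (cone_le_a (le_trans v'v vu)).
move=> B q qp Bb.
apply: (@forces_finite _ _ (fun y => fAnd (fMem y B) (fMem y generic_union))) => s sq.
have [t [ts [[x ?] [_ Bx]]]] := Bb s sq.
(* A point of [b (val u)] stays in the [b] of every stronger condition, which is disjoint from its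
   [a], and so never enters the union. What is left of [b x] is finite. *)
have [u ut xu] := cone_unbounded t x.
have [_ /finite_nat_boundP[N hN]] := sub _ _ xu.
exists u, N; split; first exact: le_trans ts.
move=> y v vu [yB yc].
have eqB := forces_eq_le (le_trans vu ut) Bx.
have [v1 [n [v1v bn eqn]]] := check_set_witness (forces_mem_eqr yB eqB).
have [v2 [k [v2v1 ak eqk]]] := generic_union_witness (forces_mem_le v1v yc).
have nk : n = k.
  apply: (@forces_eq_check_nat _ _ n k v2); apply: forces_eq_trans eqk.
  by apply: forces_eq_sym; exact: forces_eq_le eqn.
exists v1, n; split=> //; apply: hN; split=> // bnu.
have bn2 : b (val v2) n.
  exact: (cone_le_b (le_trans v2v1 (le_trans v1v vu))).
have /seteqP[abF _] := ab0 (val v2).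
by apply: (abF n); split=> //; rewrite nk.
Qed.

End GapForcing.

Theorem theorem1p2 (d : Order.disp_t) (W : orderType d) (W_omega1 : is_omega1 W)
    (scheme3 : exists (m n r : nat -> nat) (F : set {fset W})
        (rho : {fset W} -> nat) (R : {fset W} -> {fset W}),
      is_type m n r /\ construction_scheme m n r F rho R /\
      capturing n F rho R 3) :
  (exists a b : W -> set nat, gap a b /\ T_gap a b) /\
  (exists a b : W -> set nat, gap a b /\
     exists (dP : Order.disp_t) (P : porderType dP),
       inhabited P /\ ccc P /\ forces_filled P a b).
Proof.
have [m [n [r [F [rho [R [mnr [scheme capt]]]]]]]] := scheme3.
have T := T_gap_of_scheme W_omega1 mnr scheme capt.
pose a := gap_a (piece_parity m r F rho); pose b := gap_b (piece_parity m r F rho).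
split; first by exists a, b; split=> //; exact: T.1.
exists a, b; split; first exact: T.1.
have [w wP] := exists_uncountable_cone W_omega1 T.
exists d, (cone a b w); split; [|split].
- by constructor; exists w; exact: extends_refl.
- exact: (@cone_ccc _ _ _ _ T w).
- exact (cone_forces_filled W_omega1 T wP).
Qed.
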